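(* Let $q$ be an odd prime power and let $\beta,a,b,c\in\mathbb F_{q^2}$ with $\beta\neq0$. Let $A_0=\beta^{-1}(b-a^q)^2-8c$, $A_1=\beta^{-1}(b^2-a^{2q})-4c$ and $A_2=\beta^{-1}(a^q+b)^2$. Let $M$ be the number of zeros of $-\beta^qx^{2q}+\beta x^2+ax^q+bx+c$ in $\mathbb F_{q^2}$. If $a^q+b\neq0$, then $M$ is equal to \begin{itemize} \item $1+\eta(\operatorname{N}(\beta))\,\eta\big(\operatorname{Tr}(A_1)^2+\operatorname{Tr}(A_0(A_2^q-A_2))\big)$ if $A_2\notin\mathbb F_q$; \item $1$ if $A_2\in\mathbb F_q$ and $\operatorname{Tr}(A_1)\neq0$; \item $1-\eta(\operatorname{N}(\beta))$ if $A_2\in\mathbb F_q$, $\operatorname{Tr}(A_1)=0$ and $A_0\notin\mathbb F_q$; \item $1+\eta(\operatorname{N}(\beta))(q-1)$ if $A_2\in\mathbb F_q$, $\operatorname{Tr}(A_1)=0$ and $A_0\in\mathbb F_q$. \end{itemize} If $a^q+b=0$, then $M$ is equal to \begin{itemize} \item $0$ if $\operatorname{Tr}(c)\neq0$; \item $q-\eta(\operatorname{N}(\beta))$ if $\operatorname{Tr}(c)=0$ and $\beta^{-1}a^{2q}-\beta^{-q}a^2-4c\neq0$; \item $q+\eta(\operatorname{N}(\beta))(q-1)$ if $\operatorname{Tr}(c)=\beta^{-1}a^{2q}-\beta^{-q}a^2-4c=0$. \end{itemize}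
   Context: $\operatorname{Tr}(x)=x^q+x$ and $\operatorname{N}(x)=x^{q+1}$ for $x\in\mathbb F_{q^2}$. $\eta$ is the quadratic character of $\mathbb F_q^*$ (value $1$ on nonzero squares, $-1$ on nonsquares), with the convention $\eta(0)=0$. The number of zeros means the number of distinct elements at which the polynomial vanishes. *)

(* Defs.v *)
From HB Require Import structures.
From mathcomp Require Import all_boot all_order all_algebra.
From mathcomp Require Import all_field.
From mathcomp Require Import ring zify.

Set Implicit Arguments.
Unset Strict Implicit.
Unset Printing Implicit Defensive.

Import GRing.Theory.
Local Open Scope ring_scope.

Definition odd_prime_power (q : nat) : Prop :=
  exists p n : nat, [/\ prime p, odd p, (0 < n)%N & q = (p ^ n)%N].

(* The subfield F_q of a field F with q ^ 2 elements, as the set fixed by the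
   Frobenius map x |-> x ^+ q. By Fq_divring_closed and card_Fq below, it is
   indeed a subfield with q elements. *)
Definition Fq (F : finFieldType) (q : nat) : {set F} :=
  [set x : F | x ^+ q == x].

Definition Tr (F : finFieldType) (q : nat) (x : F) : F := x ^+ q + x.

Definition Nm (F : finFieldType) (q : nat) (x : F) : F := x ^+ q.+1.

(* The quadratic character of F_q, extended by 0 at 0. Squares are taken in
   F_q, since every element of F_q is a square in F. Only the values at x in
   F_q are meaningful. *)
Definition quad_char (F : finFieldType) (q : nat) (x : F) : int :=
  if x == 0 then 0
  else if [exists y in Fq F q, x == y ^+ 2] then 1 else - 1.

Definition num_zeros (F : finFieldType) (P : {poly F}) : nat :=
  #|[set x : F | root P x]|.

Lemma odd_prime_power_gt1 (q : nat) : odd_prime_power q -> (1 < q)%N.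
Proof.
by move=> [p [n [pp _ n0 ->]]]; rewrite -(exp1n n) ltn_exp2r ?prime_gt1.
Qed.

Lemma exprqD (F : finFieldType) (q : nat) (x y : F) :
  odd_prime_power q -> #|F| = (q ^ 2)%N -> (x + y) ^+ q = x ^+ q + y ^+ q.
Proof.
move=> [p [n [pp _ n0 ->]]]; rewrite -expnM => hF; apply: exprDn_pchar.
by rewrite pnatX pnatE // (card_finPcharP hF pp).
Qed.

Lemma Fq_divring_closed (F : finFieldType) (q : nat) :
  odd_prime_power q -> #|F| = (q ^ 2)%N -> divring_closed (mem (Fq F q)).
Proof.
move=> hq hF; split=> [|x y|x y]; rewrite ?inE ?expr1n //.
  move=> /eqP hx /eqP hy; rewrite exprqD // hx.
  have : (y - y) ^+ q = 0.
    by rewrite subrr expr0n eqn0Ngt ltnW ?odd_prime_power_gt1.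
  by rewrite exprqD // hy => /eqP; rewrite addrC addr_eq0 => /eqP ->.
by move=> /eqP hx /eqP hy; rewrite expr_div_n hx hy.
Qed.

Lemma card_Fq (F : finFieldType) (q : nat) :
  odd_prime_power q -> #|F| = (q ^ 2)%N -> #|Fq F q| = q.
Proof.
move=> hq hF; have q1 := odd_prime_power_gt1 hq.
set P : {poly F} := 'X^q - 'X.
have sP : size P = q.+1 by rewrite size_polyDl ?size_polyXn // size_polyN size_polyX.
have PE : P = 'X * ('X^(q.-1) - 1).
  by rewrite mulrBr mulr1 -exprS prednK // ltnW.
have dP : P %| \prod_(x <- enum F) ('X - x%:P).
  rewrite big_enum /= -finField_genPoly hF PE.
  have -> : 'X^(q ^ 2) - 'X = 'X * (('X^(q.-1)) ^+ q.+1 - 1) :> {poly F}.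
    rewrite -exprM mulrBr mulr1 -exprS; congr ('X^_ - _).
    by case: (q) q1 => // k _; rewrite -pred_Sn; ring.
  by rewrite [X in _ %| _ * X]subrX1 mulrA dvdp_mulr.
have [m Em] := dvdp_prod_XsubC dP.
set s := mask m (enum F) in Em.
have us : uniq s by rewrite mask_uniq ?enum_uniq.
have -> : #|Fq F q| = #|s|.
  apply: eq_card => x; rewrite !inE -(root_prod_XsubC s) -(eqp_root Em).
  by rewrite rootE !hornerE subr_eq0.
by rewrite (card_uniqP us); apply: succn_inj; rewrite -sP (eqp_size Em) size_prod_XsubC.
Qed.

Lemma Tr_Fq (F : finFieldType) (q : nat) (x : F) :
  odd_prime_power q -> #|F| = (q ^ 2)%N -> Tr q x \in Fq F q.
Proof.
by move=> hq hF; rewrite inE /Tr exprqD // -exprM mulnn -hF expf_card addrC.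
Qed.

Lemma Nm_Fq (F : finFieldType) (q : nat) (x : F) :
  odd_prime_power q -> #|F| = (q ^ 2)%N -> Nm q x \in Fq F q.
Proof.
by move=> hq hF; rewrite inE /Nm exprS exprMn -exprM mulnn -hF expf_card mulrC.
Qed.

(* Main.v *)
Require Import Defs.
From HB Require Import structures.
From mathcomp Require Import all_boot all_order all_algebra.
From mathcomp Require Import all_field.
From mathcomp Require Import fingroup cyclic ring zify.

Set Implicit Arguments.
Unset Strict Implicit.
Unset Printing Implicit Defensive.

Import GRing.Theory.
Local Open Scope ring_scope.

(** Write [bar x] for the conjugate [x ^+ q]. An element [u] of [F] vanishes
    iff [u + bar u = 0] and [u - bar u = 0], because the characteristic is odd.
    For [u] the value of the polynomial at [x], the part
    [beta * x ^+ 2 - bar (beta * x ^+ 2)] changes sign under conjugation, so it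
    cancels from [u + bar u], which leaves an affine trace condition. Completing
    the square in [u - bar u] with the substitution
    [y = 4 * x + beta^-1 * (b - bar a)] turns the two conditions into
    [Tr (d * y) = Tr A1] and [beta * y ^+ 2 - A0 \in Fq], where [d = bar a + b]
    (lemma [card_zeros]).

    If [d = 0], the first condition is [Tr c = 0], and the second prescribes the
    value at [y] of the form [beta * y ^+ 2 - bar (beta * y ^+ 2)], whose values
    are elements of trace zero. The fibre over 0 is explicit: for
    [eta (N beta) = 1] the form becomes, after a scaling of [y], proportional to
    [y ^+ 2 - bar y ^+ 2], which vanishes where [bar y = y] or [bar y = - y],
    and for [eta (N beta) = -1] it vanishes at 0 only. Every element of [Fq] is
    a square in [F], so scaling [y] by the roots of such elements permutes the
    other fibres transitively: they have equal cardinals, and a count of [F]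
    gives their common value ([card_imag_fibre]).

    If [d != 0], put [k = d * y]. The conditions are [Tr k = Tr A1] and
    [k ^+ 2 / A2 - A0 \in Fq]. If [A2] is in [Fq], then
    [k ^+ 2 - bar k ^+ 2 = Tr k * (k - bar k)] makes the second condition linear
    in [k], and [eta (N beta) = 1]. Otherwise
    [rho = (bar A2 - A2) * k + A2 * Tr A1] is in [Fq] exactly when
    [Tr k = Tr A1], and the second condition becomes
    [rho ^+ 2 = N A2 * (Tr A1 ^+ 2 + Tr (A0 * (bar A2 - A2)))]. The number of
    solutions [rho] in [Fq] is read off from the quadratic character, and
    [N A2] differs from [N beta] by a square of [Fq]. *)

Section QuadraticExtension.

Variables (q : nat) (F : finFieldType).
Hypotheses (hq : odd_prime_power q) (hF : #|F| = (q ^ 2)%N).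

Local Notation bar x := (x ^+ q).

(** * Conjugation, fixed elements and trace-zero elements *)

Lemma q_gt1 : (1 < q)%N.
Proof. exact: odd_prime_power_gt1 hq. Qed.

Lemma odd_q : odd q.
Proof. by have [p [n [_ op _ ->]]] := hq; rewrite oddX op orbT. Qed.

Lemma two_neq0 : 2%:R != 0 :> F.
Proof.
have [p [n [pp op n0 qE]]] := hq.
have pF : p \in [pchar F].
  by apply: (@card_finPcharP _ _ (n * 2)) => //; rewrite hF qE expnM.
apply/negP; rewrite -(dvdn_pcharf pF) => /dvdn_leq /= /(_ isT).
by have := prime_gt1 pp; case: p {pp pF qE} op => [|[|[|p]]].
Qed.

Lemma FqE x : (x \in Fq F q) = (bar x == x).
Proof. by rewrite inE. Qed.

Lemma barD (x y : F) : bar (x + y) = bar x + bar y.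
Proof. exact: exprqD. Qed.

Lemma barN (x : F) : bar (- x) = - bar x.
Proof. by rewrite exprNn -signr_odd odd_q mulN1r. Qed.

Lemma barM (x y : F) : bar (x * y) = bar x * bar y.
Proof. exact: exprMn. Qed.

Lemma bar_nat n : bar (n%:R : F) = n%:R.
Proof.
elim: n => [|n IH]; first by rewrite expr0n eqn0Ngt ltnW ?q_gt1.
by rewrite -natr1 barD IH expr1n.
Qed.

Lemma bar0 : bar (0 : F) = 0. Proof. exact: (bar_nat 0). Qed.

Lemma barX (x : F) n : bar (x ^+ n) = bar x ^+ n.
Proof. by rewrite -!exprM mulnC. Qed.

Lemma barV (x : F) : bar (x^-1) = (bar x)^-1.
Proof. exact: exprVn. Qed.

Lemma barK (x : F) : bar (bar x) = x.
Proof. by rewrite -exprM mulnn -hF expf_card. Qed.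

Lemma bar_eq0 (x : F) : (bar x == 0) = (x == 0).
Proof. by rewrite expf_eq0 ltnW // q_gt1. Qed.

(* The order matters: up to conversion, [barM] also matches the powers that
   [barX] is meant for, and [barD] the numerals meant for [bar_nat]. *)
Let barE := (barK, bar_nat, barX, barV, barM, barN, barD).

Definition trace_zero := [set x : F | bar x == - x].

Lemma trace_zeroP (x : F) : reflect (bar x = - x) (x \in trace_zero).
Proof. by rewrite inE; apply: eqP. Qed.

Lemma sub_bar_trace_zero (x : F) : x - bar x \in trace_zero.
Proof. by rewrite inE !barE opprB. Qed.

Lemma neq_opp (x : F) : x != 0 -> x != - x.
Proof.
move=> x0; apply/eqP => xN; have /eqP : 2%:R * x = 0.
  by rewrite mulr_natl mulr2n {1}xN addNr.
by rewrite mulf_eq0 (negPf two_neq0) (negPf x0).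
Qed.

Lemma Fq_trace_zero : Fq F q :&: trace_zero = [set 0].
Proof.
apply/setP => x; rewrite !inE; apply/andP/eqP => [[/eqP -> /eqP xN]|->].
  by apply/eqP; apply: contraT => /neq_opp; rewrite -xN eqxx.
by rewrite bar0 oppr0 eqxx.
Qed.

Lemma trace_zero_neq0 : exists2 k : F, k \in trace_zero & k != 0.
Proof.
have /subsetPn[x _ xFq] : ~~ ([set: F] \subset Fq F q).
  apply/negP => /subset_leq_card; rewrite cardsT hF card_Fq //.
  by have := q_gt1; nia.
exists (x - bar x); first exact: sub_bar_trace_zero.
by rewrite subr_eq0 eq_sym -FqE.
Qed.

(** Multiplication by a nonzero element of trace zero exchanges the subfield
    and the trace-zero elements. *)
Lemma card_trace_zero : #|trace_zero| = q.
Proof.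
have [k /trace_zeroP kK k0] := trace_zero_neq0.
rewrite -[RHS](card_Fq hq hF) -(card_preimset trace_zero (mulfI k0)).
apply: eq_card => x; rewrite !inE !barE kK mulNr eqr_opp.
by rewrite (inj_eq (mulfI k0)).
Qed.

Lemma sqr_Fq (x : F) :
  (x ^+ 2 \in Fq F q) = (x \in Fq F q) || (x \in trace_zero).
Proof. by rewrite !inE barX eqf_sqr. Qed.

(** * Squares in the subfield *)

(** A nonzero [t] of the subfield satisfies [t ^+ (q - 1) = 1] in a cyclic
    group of order [(q - 1) * (q + 1)], so it is a [(q + 1)]-st power, and
    [q + 1] is even. The conjugate of a square root of [t] is then again a
    square root of [t]. *)
Lemma Fq_sqrt t : t \in Fq F q ->
  exists2 l : F, t = l ^+ 2 & l \in Fq F q :|: trace_zero.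
Proof.
move=> tFq; suff [l tl] : exists l : F, t = l ^+ 2.
  by exists l => //; rewrite inE -sqr_Fq -tl.
have [->|t0] := eqVneq t 0; first by exists 0; rewrite expr0n.
have /cyclicP[g gE] := field_unit_group_cyclic [set: {unit F}]%G.
have tU : t \is a GRing.unit by rewrite unitfE.
have := in_setT (FinRing.unit F tU); rewrite gE => /cycleP[k tk].
have og : #[g]%g = (q.-1 * q.+1)%N.
  rewrite /order -gE card_finField_unit hF.
  by rewrite -mulnn; have := q_gt1; nia.
have : (FinRing.unit F tU ^+ q.-1)%g == 1%g.
  apply/eqP/val_inj; rewrite FinRing.val_unitX; apply: (mulfI t0) => /=.
  by rewrite mulr1 -exprS prednK ?(ltnW q_gt1) //; apply/eqP; rewrite -FqE.
rewrite tk -expgM -order_dvdn og mulnC dvdn_pmul2r; last by have := q_gt1; lia.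
(* The exponent k of t is a multiple of q + 1, which is even. *)
move=> q1k; have /dvdnP[j kj] : (2 %| k)%N.
  by apply: dvdn_trans q1k; rewrite dvdn2 /= odd_q.
exists (val (g ^+ j)%g).
by rewrite -FinRing.val_unitX -expgM -kj -tk.
Qed.

(** The quadratic character of [t] tells whether conjugation fixes or negates
    the square roots of [t]; this makes it multiplicative. *)
Lemma quad_char_sqr (l : F) : l \in Fq F q :|: trace_zero -> l != 0 ->
  quad_char q (l ^+ 2) = if l \in Fq F q then 1 else - 1.
Proof.
rewrite inE => lW l0; rewrite /quad_char expf_eq0 (negPf l0) /=.
congr (if _ then _ else _); apply/existsP/idP => [[y /andP[yFq]]|lFq].
  rewrite eqf_sqr => /orP[/eqP ->//|/eqP ->].
  by rewrite FqE barN eqr_opp -FqE.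
by exists l; rewrite lFq eqxx.
Qed.

Lemma quad_charM s t : s \in Fq F q -> t \in Fq F q ->
  quad_char q (s * t) = quad_char q s * quad_char q t.
Proof.
have q0 : quad_char q (0 : F) = 0 by rewrite /quad_char eqxx.
move=> /Fq_sqrt[k -> kW] /Fq_sqrt[l -> lW].
have [->|k0] := eqVneq k 0; first by rewrite expr0n mul0r q0 mul0r.
have [->|l0] := eqVneq l 0; first by rewrite expr0n mulr0 q0 mulr0.
have kl0 : k * l != 0 by rewrite mulf_neq0.
have klW : k * l \in Fq F q :|: trace_zero.
  rewrite inE -sqr_Fq exprMn FqE barM.
  by move: kW lW; rewrite !in_setU -!sqr_Fq !FqE => /eqP -> /eqP ->.
rewrite -exprMn !quad_char_sqr //.
have [kFq|/negP kFq] := boolP (k \in Fq F q);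
  have [lFq|/negP lFq] := boolP (l \in Fq F q); rewrite ?mul1r ?mulr1.
- by move: kFq lFq; rewrite !FqE barM => /eqP -> /eqP ->; rewrite eqxx.
- case: ifP => // /[!FqE]; rewrite barM; move: kFq; rewrite FqE => /eqP ->.
  by rewrite (inj_eq (mulfI k0)) -FqE => /lFq.
- case: ifP => // /[!FqE]; rewrite barM; move: lFq; rewrite FqE => /eqP ->.
  by rewrite (inj_eq (mulIf l0)) -FqE => /kFq.
- move: kW lW; rewrite !in_setU => /orP[/kFq//|/trace_zeroP kN].
  by move=> /orP[/lFq//|/trace_zeroP lN]; rewrite FqE barM kN lN mulrNN eqxx.
Qed.

Lemma card_Fq_sqrt t : t \in Fq F q ->
  #|[set r in Fq F q | r ^+ 2 == t]|%:Z = 1 + quad_char q t.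
Proof.
move=> /Fq_sqrt[l -> lW].
have [->|l0] := eqVneq l 0.
  rewrite expr0n /quad_char eqxx addr0.
  rewrite -[RHS]/(Posz 1) -[in RHS](cards1 (0 : F)); congr Posz.
  apply: eq_card => r; rewrite !inE expf_eq0 /=.
  by have [->|_] := eqVneq r 0; rewrite ?andbF // bar0 eqxx.
rewrite quad_char_sqr //; case: ifP => lFq.
  transitivity #|[set l; - l]|%:Z; last by rewrite cards2 neq_opp.
  congr Posz; apply: eq_card => r; rewrite inE in_set2 eqf_sqr.
  have [->|_] := eqVneq r l; first by rewrite lFq.
  have [->|_] := eqVneq r (- l); rewrite ?andbF //.
  by rewrite FqE barN eqr_opp -FqE lFq.
rewrite addrN; apply/eqP; rewrite eqz_nat cards_eq0; apply/eqP/setP => r.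
rewrite in_set0 inE eqf_sqr; apply/negP => /andP[rFq /orP[]/eqP rl].
  by rewrite -rl rFq in lFq.
by move: rFq; rewrite rl FqE barN eqr_opp -FqE lFq.
Qed.

(** * Fibres of a quadratic form with values of trace zero *)

Variable beta : F.
Hypothesis beta0 : beta != 0.

(** If [beta * z ^+ 2 = t] with [t] in the subfield, then
    [N beta = (t / N z) ^+ 2]. Conversely, if [N beta = n ^+ 2], then
    [beta * (bar beta + n) ^+ 2 = n ^+ 2 * (Tr beta + 2 * n)], so
    [z = bar beta + n] works unless it vanishes; in that case [beta] itself is
    in the subfield. *)
Lemma quad_char_Nm_eq1P :
  reflect (exists2 z : F, z != 0 & beta * z ^+ 2 \in Fq F q)
          (quad_char q (Nm q beta) == 1).
Proof.
have N0 : Nm q beta != 0 by rewrite expf_neq0.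
rewrite /quad_char (negPf N0); apply: (iffP eqP).
  case: ifP => // /existsP[n /andP[]]; rewrite FqE => /eqP nn /eqP Nn _.
  have [bn|bn] := eqVneq (bar beta) (- n).
    exists 1; first exact: oner_neq0.
    rewrite FqE expr1n mulr1 bn; apply/eqP.
    by rewrite -[RHS]barK bn barN nn.
  exists (bar beta + n); first by rewrite addr_eq0.
  have {}Nn : beta * bar beta = n ^+ 2 by rewrite -exprS.
  have -> : beta * (bar beta + n) ^+ 2 = n ^+ 2 * (bar beta + beta + 2%:R * n).
    by rewrite -Nn; ring: Nn.
  by rewrite FqE !barE nn [beta + _]addrC.
move=> [z z0]; rewrite FqE => /eqP tt; case: ifP => // /existsP[].
exists (beta * z ^+ 2 / Nm q z).
have NzFq := Nm_Fq z hq hF.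
rewrite !inE in NzFq *; rewrite [X in X == _]expr_div_n tt (eqP NzFq) eqxx /=.
rewrite expr_div_n expr2 -{1}tt barM barX /Nm !(exprS _ q).
have := bar_eq0 z; rewrite (negPf z0) => /negbT bz0.
move: (bar z) (bar beta) bz0 => z' beta' z'0; apply/eqP; field.
by rewrite z'0.
Qed.

Lemma quad_char_Nm_cases :
  quad_char q (Nm q beta) = 1 \/ quad_char q (Nm q beta) = - 1.
Proof.
rewrite /quad_char expf_eq0 (negPf beta0) andbF.
by case: ifP => _; [left|right].
Qed.

Definition imag_fibre (E : F) :=
  [set y : F | beta * y ^+ 2 - bar (beta * y ^+ 2) == E].

(** If [beta * z ^+ 2] is in the subfield for some nonzero [z], then
    [y = z * w] is in the fibre iff [w ^+ 2] is in the subfield, that is iff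
    [w] is in the subfield or has trace zero: this gives [2 * q - 1] elements.
    Otherwise only [y = 0] remains. *)
Lemma card_imag_fibre0 :
  #|imag_fibre 0|%:Z = q%:Z + quad_char q (Nm q beta) * (q%:Z - 1).
Proof.
case: quad_char_Nm_cases => e.
  have /eqP/quad_char_Nm_eq1P[z z0 zFq] := e.
  have zI0 : z^-1 != 0 by rewrite invr_eq0.
  have -> : imag_fibre 0 = ( *%R z^-1) @^-1: (Fq F q :|: trace_zero).
    apply/setP => y; rewrite [RHS]in_set in_setU -sqr_Fq FqE [LHS]in_set.
    have {1 2}-> : beta * y ^+ 2 = (beta * z ^+ 2) * (z^-1 * y) ^+ 2.
      by field.
    move: zFq; rewrite FqE barM => /eqP ->; rewrite -mulrBr mulf_eq0.
    rewrite mulf_eq0 (negPf beta0) expf_eq0 (negPf z0) /=.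
    by rewrite subr_eq0 eq_sym.
  rewrite (card_preimset _ (mulfI zI0)) cardsU Fq_trace_zero cards1.
  by rewrite card_Fq // card_trace_zero e; have := q_gt1; lia.
have -> : imag_fibre 0 = [set 0].
  apply/setP => y; rewrite !inE.
  have [->|y0] := eqVneq y 0; first by rewrite expr0n mulr0 bar0 subrr eqxx.
  rewrite subr_eq0 eq_sym -FqE; apply/negP => yFq.
  have /quad_char_Nm_eq1P : exists2 z : F, z != 0 & beta * z ^+ 2 \in Fq F q.
    by exists y.
  by rewrite e.
by rewrite cards1 e; lia.
Qed.

(** For nonzero [E] and [E'] of trace zero, [E / E'] is in the subfield, hence a
    square [l ^+ 2] of [F], and [y |-> l * y] maps the fibre over [E'] onto the
    fibre over [E]. The [q - 1] nonzero fibres therefore share equally what the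
    fibre over 0 leaves of the [q ^ 2] elements of [F]. *)
Lemma card_imag_fibre E : E \in trace_zero -> E != 0 ->
  #|imag_fibre E|%:Z = q%:Z - quad_char q (Nm q beta).
Proof.
move=> EK E0.
have sameE E' : E' \in trace_zero :\ 0 -> #|imag_fibre E'| = #|imag_fibre E|.
  rewrite in_setD1 => /andP[E'0 E'K].
  have /Fq_sqrt[l lE lW] : E / E' \in Fq F q.
    rewrite FqE barM barV (trace_zeroP _ EK) (trace_zeroP _ E'K).
    by rewrite invrN mulrNN.
  have l0 : l != 0.
    apply: contraNneq (mulf_neq0 E0 (invr_neq0 E'0)) => l0.
    by rewrite lE l0 expr0n.
  rewrite -(card_preimset (imag_fibre E) (mulfI l0)).
  apply: eq_card => y; rewrite !inE.
  have -> : beta * (l * y) ^+ 2 = l ^+ 2 * (beta * y ^+ 2) by ring.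
  have -> : bar (l ^+ 2 * (beta * y ^+ 2)) = l ^+ 2 * bar (beta * y ^+ 2).
    by rewrite barM; congr (_ * _); apply/eqP; rewrite -FqE sqr_Fq -in_setU.
  rewrite -mulrBr -(inj_eq (mulfI (expf_neq0 2 l0)) _ E').
  by rewrite -{2}lE divfK.
have : #|F| = (#|imag_fibre 0%R| + #|imag_fibre E| * q.-1)%N.
  rewrite -cardsT -sum1_card.
  rewrite (partition_big (fun y => beta * y ^+ 2 - bar (beta * y ^+ 2))
            (mem trace_zero)) /=; last first.
    by move=> y _; apply: sub_bar_trace_zero.
  have zK : 0 \in trace_zero by rewrite inE bar0 oppr0.
  rewrite (bigD1 0) //=; congr (_ + _)%N.
    by rewrite -sum1_card; apply: eq_bigl => y; rewrite !inE.
  have -> : q.-1 = #|trace_zero :\ 0|.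
    by have := cardsD1 0 trace_zero; rewrite zK card_trace_zero => ->.
  rewrite mulnC -sum_nat_const.
  apply: eq_big => [E'|E' E'K]; first by rewrite in_setD1 andbC.
  rewrite -(sameE E') ?in_setD1 1?andbC // -sum1_card.
  by apply: eq_bigl => y; rewrite !inE.
have := card_imag_fibre0; rewrite hF; have := q_gt1.
by case: quad_char_Nm_cases => ->; nia.
Qed.

(** * Elements of given trace whose square is constrained *)

Definition trace_square_set (T A A0 : F) :=
  [set k : F | (Tr q k == T) && (k ^+ 2 / A - A0 \in Fq F q)].

(** The second condition becomes linear because
    [bar k ^+ 2 - k ^+ 2 = Tr k * (bar k - k)]. *)
Lemma trace_square_set_Fq T A A0 : A \in Fq F q -> A != 0 ->
  trace_square_set T A A0 =
    [set k | (Tr q k == T) && (T * (bar k - k) == A * (bar A0 - A0))].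
Proof.
rewrite FqE => /eqP AA An0; apply/setP => k; rewrite !inE.
case: eqP => //= <-; rewrite !barE AA /Tr -(inj_eq (mulfI An0)).
rewrite -subr_eq0 -[RHS]subr_eq0; congr (_ == 0).
by move: (bar k) (bar A0) => k' A0'; field.
Qed.

(** Both [bar k + k] and [bar k - k] are prescribed, and [k] is half the
    difference of these values. *)
Lemma card_trace_square_set_Fq T A A0 :
  A \in Fq F q -> A != 0 -> T \in Fq F q -> T != 0 ->
  #|trace_square_set T A A0| = 1%N.
Proof.
move=> AFq An0; rewrite trace_square_set_Fq //.
move: AFq; rewrite !FqE => AFq /eqP TT Tn0.
set s := A * (bar A0 - A0) / T.
have sK : bar s = - s.
  by rewrite !barE (eqP AFq) TT /s -mulNr -mulrN opprB.
rewrite -(cards1 ((T - s) / 2%:R)); apply: eq_card => k; rewrite !inE.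
have -> : (T * (bar k - k) == A * (bar A0 - A0)) = (bar k - k == s).
  rewrite -(inj_eq (mulfI Tn0) _ s) /s; congr (_ == _).
  by field.
move: s sK => s sK; apply/andP/eqP => [[/eqP <- /eqP <-]|->].
  by rewrite /Tr; move: (bar k) => k'; field; exact: two_neq0.
by rewrite /Tr !barE TT sK; split; apply/eqP; field; exact: two_neq0.
Qed.

Lemma card_trace_square_set_Fq0 A A0 : A \in Fq F q -> A != 0 ->
  #|trace_square_set 0 A A0| = if A0 \in Fq F q then q else 0%N.
Proof.
move=> AFq An0; rewrite trace_square_set_Fq //.
case: ifPn => [/[!FqE] A0Fq|A0Fq].
  rewrite -[RHS]card_trace_zero; apply: eq_card => k; rewrite !inE.
  by rewrite (eqP A0Fq) subrr mulr0 mul0r eqxx andbT addr_eq0.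
apply/eqP; rewrite cards_eq0; apply/eqP/setP => k; rewrite !inE.
rewrite mul0r [0 == _]eq_sym mulf_eq0 (negPf An0) /= subr_eq0 -FqE.
by rewrite (negPf A0Fq) andbF.
Qed.

(** With [D = bar A - A], completing the square in [k] leads to
    [rho = D * k + A * T]. Since [bar rho - rho = D * (T - Tr k)], the trace
    condition on [k] says that [rho] is in the subfield, and under it the other
    condition says that [rho ^+ 2] has a prescribed value there. *)
Lemma card_trace_square_set T A A0 : A \notin Fq F q -> T \in Fq F q ->
  #|trace_square_set T A A0|%:Z =
    1 + quad_char q (Nm q A) * quad_char q (T ^+ 2 + Tr q (A0 * (bar A - A))).
Proof.
rewrite !FqE => AFq TFq; have /eqP TT := TFq.
set D := bar A - A; have D0 : D != 0 by rewrite subr_eq0.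
have DK : bar D = - D by rewrite !barE opprB.
have An0 : A != 0 by apply: contraNneq AFq => ->; rewrite bar0.
set G := T ^+ 2 + _.
have GFq : G \in Fq F q.
  rewrite FqE barD barX TT.
  by have := Tr_Fq (A0 * D) hq hF; rewrite FqE => /eqP ->.
have NFq := Nm_Fq A hq hF.
rewrite -quad_charM // -card_Fq_sqrt; last first.
  by move: NFq GFq; rewrite !FqE barM => /eqP -> /eqP ->.
congr Posz.
have inj_f : injective (fun k => D * k + A * T).
  by move=> k l /addIr /(mulfI D0).
rewrite -[RHS](card_preimset _ inj_f); apply: eq_card => k; rewrite !inE.
have -> : (bar (D * k + A * T) == D * k + A * T) = (Tr q k == T).
  rewrite !barD !barM DK TT -[RHS](inj_eq (mulfI D0)) -subr_eq0 -[RHS]subr_eq0.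
  rewrite -oppr_eq0; congr (_ == 0); rewrite /Tr /D.
  by move: (bar A) (bar k) => A' k'; ring.
case: eqP => //= Tk.
have A'0 : bar A != 0 by rewrite bar_eq0.
rewrite -subr_eq0 -[RHS]subr_eq0.
have -> : (D * k + A * T) ^+ 2 - Nm q A * G =
  - (D * (A * bar A)) * (bar (k ^+ 2 / A - A0) - (k ^+ 2 / A - A0)).
  rewrite /G -Tk /Tr !barD !barN (barM _ A^-1)
    (barM A0) barX barV DK /D /Nm (exprS _ q).
  move: (bar A) (bar k) (bar A0) A'0 => A' k' A0' A'0.
  by field; rewrite A'0 An0.
by rewrite mulf_eq0 oppr_eq0 !mulf_eq0 (negPf D0) (negPf An0) (negPf A'0).
Qed.

(** * Reduction of the equation *)

(** The product of the two norms is [N d ^+ 2]. *)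
Lemma quad_char_Nm_div (d : F) : d != 0 ->
  quad_char q (Nm q (beta^-1 * d ^+ 2)) = quad_char q (Nm q beta).
Proof.
move=> d0; have NFq x := Nm_Fq x hq hF.
have : quad_char q (Nm q (beta^-1 * d ^+ 2)) * quad_char q (Nm q beta) = 1.
  rewrite -quad_charM // -exprMn.
  have -> : beta^-1 * d ^+ 2 * beta = d ^+ 2 by field.
  rewrite exprAC -[_ ^+ q.+1]/(Nm q d) quad_char_sqr ?expf_neq0 //.
    by rewrite NFq.
  by rewrite inE NFq.
by case: quad_char_Nm_cases => ->; lia.
Qed.

Lemma quad_char_Nm_Fq (d : F) : d != 0 -> beta^-1 * d ^+ 2 \in Fq F q ->
  quad_char q (Nm q beta) = 1.
Proof.
move=> d0 AFq; apply/eqP/quad_char_Nm_eq1P; exists d^-1.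
  by rewrite invr_eq0.
have -> : beta * d^-1 ^+ 2 = (beta^-1 * d ^+ 2)^-1.
  by field; rewrite d0 beta0.
by move: AFq; rewrite !FqE barV => /eqP ->.
Qed.

Definition reduced_zeros (d T A0 : F) :=
  [set y : F | (Tr q (d * y) == T) && (beta * y ^+ 2 - A0 \in Fq F q)].

Lemma card_reduced_zeros (d T A0 : F) : d != 0 ->
  #|reduced_zeros d T A0| = #|trace_square_set T (beta^-1 * d ^+ 2) A0|.
Proof.
move=> d0; rewrite -[RHS](card_preimset _ (mulfI d0)); apply: eq_card => y.
rewrite [LHS]in_set 2![RHS]in_set.
suff -> : (d * y) ^+ 2 / (beta^-1 * d ^+ 2) = beta * y ^+ 2 by [].
by field; rewrite ?d0 ?beta0.
Qed.

Lemma reduced_zeros0 (T A0 : F) :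
  reduced_zeros 0 T A0 = if T == 0 then imag_fibre (A0 - bar A0) else set0.
Proof.
apply/setP => y; rewrite inE mul0r /Tr bar0 addr0 eq_sym.
case: ifP => //= _; rewrite ?inE //= barD barN eq_sym -subr_eq0.
by rewrite -[RHS]subr_eq0; congr (_ == 0); ring.
Qed.

(** When [b = - bar a] and [c] has trace zero, the fibre in question lies over
    four times the discriminant that separates the last two cases. *)
Lemma imag_discriminant (a c : F) : bar c = - c ->
  let A0 := beta^-1 * (- bar a - bar a) ^+ 2 - 8%:R * c in
  A0 - bar A0 = 4%:R * (beta^-1 * bar a ^+ 2 - beta ^- q * a ^+ 2 - 4%:R * c).
Proof.
move=> cN A0; rewrite /A0 !barE cN.
by move: (bar a) (bar beta) => a' beta'; ring.
Qed.

(** With [u] the value of the polynomial at [x] and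
    [y = 4 * x + beta^-1 * (b - bar a)], the trace condition on [y] says that
    [4 * (bar u + u) = 0] and the condition on [beta * y ^+ 2] says that
    [8 * (u - bar u) = 0]; the factors 4 and 8 are invertible. *)
Lemma card_zeros (a b c : F) :
  num_zeros (- beta ^+ q *: 'X^(2 * q) + beta *: 'X^2 + a *: 'X^q
             + b *: 'X + c%:P)
  = #|reduced_zeros (bar a + b)
        (Tr q (beta^-1 * (b ^+ 2 - a ^+ (2 * q)) - 4%:R * c))
        (beta^-1 * (b - bar a) ^+ 2 - 8%:R * c)|.
Proof.
have four0 : 4%:R != 0 :> F by rewrite (natrM _ 2 2) mulf_neq0 ?two_neq0.
have inj_f : injective (fun x => 4%:R * x + beta^-1 * (b - bar a)).
  by move=> x y /addIr /(mulfI four0).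
rewrite -(card_preimset _ inj_f); apply: eq_card => x; rewrite !inE.
rewrite rootE !(mulnC 2%N) !exprM.
set u := - bar beta * bar x ^+ 2 + beta * x ^+ 2 + a * bar x + b * x + c.
have -> : (- bar beta *: ('X^q) ^+ 2 + beta *: 'X^2 + a *: 'X^q
             + b *: 'X + c%:P).[x] = u.
  by rewrite !(hornerD, hornerZ, horner_exp, hornerX, hornerC).
have -> : (Tr q ((bar a + b) * (4%:R * x + beta^-1 * (b - bar a))) ==
   Tr q (beta^-1 * (b ^+ 2 - bar a ^+ 2) - 4%:R * c))
   = (4%:R * (bar u + u) == 0).
  rewrite -subr_eq0; congr (_ == 0).
  rewrite /Tr /u !barE.
  by move: (bar a) (bar b) (bar c) (bar x) (bar beta) => *; ring.
set v := beta * _ - _; have -> : (bar v == v) = (8%:R * (u - bar u) == 0).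
  rewrite eq_sym -subr_eq0; congr (_ == 0).
  rewrite /v /u !barE.
  have : bar beta != 0 by rewrite bar_eq0.
  move: (bar a) (bar b) (bar c) (bar x) (bar beta) => a' b' c' x' beta' beta'0.
  by field; rewrite beta'0 beta0.
apply/eqP/andP => [->|[]]; first by rewrite bar0 subr0 addr0 !mulr0 eqxx.
rewrite (natrM _ 2 4) !mulf_eq0 (negPf two_neq0) (negPf four0) /= => /eqP s0.
rewrite subr_eq0 => /eqP us; move/eqP: s0; rewrite -us -mulr2n -mulr_natl.
by rewrite mulf_eq0 (negPf two_neq0) => /eqP.
Qed.

End QuadraticExtension.

Theorem proposition3 (q : nat) (F : finFieldType) (beta a b c : F)
    (hq : odd_prime_power q) (hF : #|F| = (q ^ 2)%N) (hbeta : beta != 0) :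
  let A0 : F := beta^-1 * (b - a ^+ q) ^+ 2 - 8%:R * c in
  let A1 : F := beta^-1 * (b ^+ 2 - a ^+ (2 * q)) - 4%:R * c in
  let A2 : F := beta^-1 * (a ^+ q + b) ^+ 2 in
  let D : F := beta^-1 * a ^+ (2 * q) - beta ^- q * a ^+ 2 - 4%:R * c in
  let P : {poly F} :=
    - beta ^+ q *: 'X^(2 * q) + beta *: 'X^2 + a *: 'X^q + b *: 'X + c%:P in
  let M : int := (num_zeros P)%:Z in
  let e : int := quad_char q (Nm q beta) in
  (a ^+ q + b != 0 ->
    [/\ A2 \notin Fq F q ->
          M = 1 + e * quad_char q
                      (Tr q A1 ^+ 2 + Tr q (A0 * (A2 ^+ q - A2))),
        A2 \in Fq F q -> Tr q A1 != 0 -> M = 1,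
        A2 \in Fq F q -> Tr q A1 = 0 -> A0 \notin Fq F q -> M = 1 - e
      & A2 \in Fq F q -> Tr q A1 = 0 -> A0 \in Fq F q ->
          M = 1 + e * (q%:Z - 1)]) /\
  (a ^+ q + b = 0 ->
    [/\ Tr q c != 0 -> M = 0,
        Tr q c = 0 -> D != 0 -> M = q%:Z - e
      & Tr q c = 0 -> D = 0 -> M = q%:Z + e * (q%:Z - 1)]).
Proof.
move=> A0 A1 A2 D P M e.
have ME : M = #|reduced_zeros q beta (a ^+ q + b) (Tr q A1) A0|%:Z.
  by rewrite /M /P (card_zeros hq hF hbeta).
have TFq : Tr q A1 \in Fq F q by apply: Tr_Fq.
split=> [d0|d0].
  have A2n0 : A2 != 0 by rewrite mulf_neq0 ?invr_eq0 ?expf_neq0.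
  have eFq : A2 \in Fq F q -> e = 1 by apply: quad_char_Nm_Fq.
  rewrite ME card_reduced_zeros //.
  split=> [A2Fq|A2Fq T0|A2Fq -> A0Fq|A2Fq -> A0Fq].
  - by rewrite (card_trace_square_set hq hF) // quad_char_Nm_div.
  - by rewrite (card_trace_square_set_Fq hq hF).
  - by rewrite (card_trace_square_set_Fq0 hq hF) // (negPf A0Fq) eFq.
  - by rewrite (card_trace_square_set_Fq0 hq hF) // A0Fq eFq //; lia.
have bE : b = - a ^+ q by rewrite -[b](addKr (a ^+ q)) d0 addr0.
have barA1 : Tr q A1 = - 4%:R * Tr q c.
  rewrite /A1 bE sqrrN mulnC exprM subrr mulr0 sub0r /Tr.
  by rewrite (barN hq) (barM q) (bar_nat hq hF); ring.
have four0 : 4%:R != 0 :> F.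
  by rewrite (natrM _ 2 2) mulf_neq0 ?(two_neq0 hq hF).
rewrite ME d0 (reduced_zeros0 hq hF) barA1 mulf_eq0 oppr_eq0 (negPf four0) /=.
have A0D : Tr q c = 0 -> A0 - A0 ^+ q = 4%:R * D.
  move=> /eqP; rewrite /Tr addr_eq0 => /eqP cN.
  by rewrite /A0 /D bE mulnC exprM (imag_discriminant hq hF).
split=> [/negPf ->|Tc D0|Tc D0]; first by rewrite cards0.
  rewrite Tc eqxx (card_imag_fibre hq hF hbeta) //.
    exact: (sub_bar_trace_zero hq hF).
  by rewrite A0D // mulf_neq0.
by rewrite Tc eqxx A0D // D0 mulr0 (card_imag_fibre0 hq hF hbeta).
Qed.
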